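(* Let $n\ge2$, $0\le k\le n-2$ and $N\ge1$ be integers. The number of tilings of the generalized Aztec diamond $AD(N,n,k)$ by $n$-ribbons equals $2^{N(N+1)/2}$. Consequently, for fixed $n,k$, as $N\to\infty$ the limit per-tile entropy of this sequence of regions is $$\mu^{(n)}=\lim_{N\to\infty}\frac{\log_2|\mathcal{T}_n(AD(N,n,k))|}{N(N+1)}=\frac12 .$$
   Context: An $n$-ribbon is a connected sequence of $n$ unit squares of the square lattice, each of which (except the first) lies directly above or directly to the right of its predecessor. A tiling of a region by $n$-ribbons is a set of $n$-ribbons with pairwise disjoint interiors whose union is the region; $\mathcal{T}_n(R)$ is the set of all tilings of $R$ by $n$-ribbons. The generalized Aztec diamond $AD(N,n,k)$ is the following union of $2N$ vertical columns of unit squares, with heights $n,2n,\dots,Nn,Nn,\dots,2n,n$ from left to right. For $j=1,\dots,N$: (left half) the column $[j-1,j]\times[-j,\,(n-1)j]$, of height $nj$; (right half) the column $[2N-j,\,2N-j+1]\times[\,b_j,\,b_j+nj\,]$ with $b_j=-N+k+(n-1)(N-j)$. Thus in the left half, moving one column to the right lowers the bottom by $1$ and raises the top by $n-1$; in the right half, moving one column to the right raises the bottom by $n-1$ and lowers the top by $1$; and the right longest column is shifted up by $k$ relative to the left longest column. $AD(N,2,0)$ is the usual Aztec diamond. The area of $AD(N,n,k)$ is $nN(N+1)$, so each tiling has $N(N+1)$ tiles. *)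

(* Defs.v *)
From HB Require Import structures.
From mathcomp Require Import all_boot all_order all_algebra finmap.
From mathcomp Require Import all_classical all_reals all_analysis.
Set Implicit Arguments.
Unset Strict Implicit.
Unset Printing Implicit Defensive.
Import Order.TTheory GRing.Theory Num.Theory.
Import numFieldNormedType.Exports.

Local Open Scope fset_scope.
Local Open Scope ring_scope.

(* The pair (x, y) stands for the unit square [x, x+1] x [y, y+1]; regions are
   finite sets of squares, so disjoint interiors means disjoint sets. *)
Notation cell := (int * int)%type.

Definition ribbon_step : rel cell :=
  fun c d => (d == (c.1, c.2 + 1)) || (d == (c.1 + 1, c.2)).

Definition is_ribbon (n : nat) (A : {fset cell}) : Prop :=
  exists s : seq cell,
    [/\ size s = n, sorted ribbon_step s & A = [fset c in s]].

Definition is_tiling (n : nat) (R : {fset cell}) (T : {fset {fset cell}}) :=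
  [/\ forall A, A \in T -> is_ribbon n A,
      {in T &, forall A B, A != B -> [disjoint A & B]}
    & fcover T = R].

(* The double powerset only serves to make the collection finite; see
   [tilingsP]. *)
Definition tilings (n : nat) (R : {fset cell}) : {fset {fset {fset cell}}} :=
  [fset T in fpowerset (fpowerset R) | `[< is_tiling n R T >]].

Lemma tilingsP n R T : T \in tilings n R <-> is_tiling n R T.
Proof.
rewrite !inE /=; split=> [/andP[_ /asboolP]//|tT].
apply/andP; split; last exact/asboolP.
case: tT => _ _ <-; rewrite fpowersetE; apply/fsubsetP => A AT.
by rewrite fpowersetE; apply: bigfcup_sup.
Qed.

(* [x, x+1] x [b, b+h] *)
Definition column (x b : int) (h : nat) : {fset cell} :=
  [fset (x, b + i%:Z) | i in iota 0 h].

Definition aztec_left (n j : nat) : {fset cell} :=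
  column (j%:Z - 1) (- j%:Z) (n * j)%N.

Definition aztec_right (N n k j : nat) : {fset cell} :=
  column (2 * N%:Z - j%:Z)
         (- N%:Z + k%:Z + (n%:Z - 1) * (N%:Z - j%:Z)) (n * j)%N.

Definition aztec (N n k : nat) : {fset cell} :=
  \bigcup_(j <- iota 1 N) (aztec_left n j `|` aztec_right N n k j).

Definition log2 {R : realType} (x : R) : R := ln x / ln 2.

(* Main.v *)
(* Call x + y + 1 the level of the square (x, y).  Every level of a ribbon contains
   exactly one of its squares, and in a tiling of AD(N, n, k) ribbons can only start
   at levels congruent to 0 or k + 1 mod n and only turn right when they enter such a
   level.  Grouping the levels in between into bands turns ribbon tilings into
   domino tilings of the usual Aztec diamond, whatever n and k are.

   These are counted by removing the bands from the top.  The squares of band 2m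
   covered by the dominoes coming from below form a set t_0 < ... < t_(m-1), and
   those of band 2m + 1 a set s_0 < ... < s_m.  The dominoes between the bands 2m and
   2m + 1 exist, and are then unique, iff s_i <= t_i < s_(i+1), and those between the
   bands 2m - 1 and 2m move each t_i to t_i or t_i + 1, all positions being counted
   from the left end of their band.  By multilinearity of the
   determinant, summing det(binomial(t_i, j)) over the first relation telescopes to
   det(binomial(s_i, j)), and the second one multiplies it by 2 ^ m.  Hence the number
   of tilings below a given t is 2 ^ (m(m+1)/2) det(binomial(t_i, j)), and the
   determinant is 1 when m = N and t is the full band. *)
Require Import Defs.
From mathcomp Require Import all_boot all_order all_algebra finmap.
From mathcomp Require Import all_classical all_reals all_analysis.
From mathcomp Require Import zify ring.
Set Implicit Arguments.
Unset Strict Implicit.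
Unset Printing Implicit Defensive.
Import Order.TTheory GRing.Theory Num.Theory.
Import numFieldNormedType.Exports.
Local Open Scope classical_set_scope.
Local Open Scope ring_scope.

(** * Determinants given by their lists of rows *)

Definition row_det (m : nat) (l : seq (nat -> int)) : int :=
  \det (\matrix_(i < m, j < m) nth (fun=> 0) l i j).

Lemma row_detD (m : nat) (l1 l2 : seq (nat -> int)) (u v w : nat -> int) :
  (size l1 < m)%N -> (forall j, w j = u j + v j) ->
  row_det m (l1 ++ w :: l2) = row_det m (l1 ++ u :: l2) + row_det m (l1 ++ v :: l2).
Proof.
move=> lt1 wE; rewrite /row_det.
pose i0 := Ordinal lt1.
have nthD x (i : 'I_m) : i != i0 ->
    nth (fun=> 0) (l1 ++ x :: l2) i = nth (fun=> 0) (l1 ++ w :: l2) i.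
  move=> ne; rewrite !nth_cat; case: ltnP => // le.
  have : (size l1 < i)%N by rewrite ltn_neqAle le andbT eq_sym.
  by rewrite -subn_gt0; case: (i - size l1)%N.
rewrite (@determinant_multilinear _ _ _ 
   (\matrix_(i < m, j < m) nth (fun=> 0) (l1 ++ u :: l2) i j)
   (\matrix_(i < m, j < m) nth (fun=> 0) (l1 ++ v :: l2) i j) i0 1 1).
- by rewrite !mul1r.
- by apply/rowP=> j; rewrite !mxE !nth_cat /= ltnn subnn /= !mul1r wE.
- by apply/matrixP => i j; rewrite !mxE nthD // eq_sym neq_lift.
- by apply/matrixP => i j; rewrite !mxE nthD // eq_sym neq_lift.
Qed.

Lemma row_det_dup (m : nat) (l1 l2 : seq (nat -> int)) (u : nat -> int) :
  (size l1 + 1 < m)%N -> row_det m (l1 ++ u :: u :: l2) = 0.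
Proof.
move=> lt1; have lt0 : (size l1 < m)%N by lia.
apply: (@determinant_alternate _ _ _ (Ordinal lt0) (Ordinal lt1)).
  by rewrite -val_eqE /=; lia.
move=> j; rewrite !mxE !nth_cat /= ltnn subnn /=.
by rewrite addn1 ltnNge leqnSn /= subSnn.
Qed.

(* Subtracting from each row the previous one leaves the first column equal to
   [1, 0, ..., 0]. *)
Lemma row_det_consecutive (m : nat) (w : nat -> nat -> int) (s0 : nat) (s : seq nat) :
  size s = m -> (forall x, w x 0%N = 1) ->
  row_det m.+1 (map w (s0 :: s)) =
  row_det m (pairmap (fun a b j => w b j.+1 - w a j.+1) s0 s).
Proof.
move=> sm w0; rewrite /row_det.
set A := \matrix_(i, j) _.
pose L : 'M[int]_m.+1 := \matrix_(i, k) ((k == i)%:R - (k.+1 == i :> nat)%:R).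
have AE (i j : 'I_m.+1) : A i j = w (nth 0%N (s0 :: s) i) j.
  by rewrite mxE (nth_map 0%N) //= sm.
have detL : \det L = 1.
  rewrite det_trig ?big1 // => [i _|].
    by rewrite mxE eqxx gtn_eqF ?subr0.
  apply/is_trig_mxP => i j ij; rewrite mxE -val_eqE /=.
  by rewrite !gtn_eqF ?subr0 // (ltn_trans ij).
have LA (i j : 'I_m.+1) : (L *m A) i j =
    A i j - (if i == 0 :> nat then 0 else w (nth 0%N (s0 :: s) i.-1) j).
  rewrite mxE; under eq_bigr => k _ do rewrite mxE mulrBl.
  rewrite sumrB; congr (_ - _).
    rewrite (bigD1 i) //= eqxx mul1r big1 ?addr0 // => k /negbTE ->.
    by rewrite mul0r.
  case: eqP => [i0|/eqP i0].
    by rewrite big1 // => k _; rewrite i0 mul0r.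
  have ip : (i.-1 < m.+1)%N by rewrite (leq_ltn_trans (leq_pred i)).
  rewrite (bigD1 (Ordinal ip)) //= prednK ?lt0n // eqxx mul1r AE big1 ?addr0 //.
  move=> k; rewrite -val_eqE /= => ki.
  suff -> : (k.+1 == i :> nat) = false by rewrite mul0r.
  by apply: contra_neqF ki => /eqP <-.
rewrite -[LHS]mul1r -detL -det_mulmx (expand_det_col _ ord0) big_ord_recl.
rewrite LA /= subr0 AE w0 mul1r big1 ?addr0; last first.
  by move=> i _; rewrite LA !AE !w0 /= subrr mul0r.
rewrite /cofactor /= addn0 expr0 mul1r.
congr (\det _); apply/matrixP => i j; rewrite 2!mxE LA AE mxE.
by rewrite (nth_pairmap 0%N) // sm.
Qed.

(* The matrix on the left is the one on the right times an upper triangular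
   matrix with diagonal entries 2. *)
Lemma row_det_double (m : nat) (g : nat -> nat -> int) (s : seq nat) :
  size s = m ->
  row_det m
    (map (fun t j => 2 * g t j + (if j is j'.+1 then g t j' else 0)) s) =
  2 ^+ m * row_det m (map g s).
Proof.
move=> sm; rewrite /row_det.
set A := \matrix_(i, j) nth _ (map g s) _ _.
pose U : 'M[int]_m := \matrix_(k, j) (2 * (k == j)%:R + (k.+1 == j :> nat)%:R).
have AE (i j : 'I_m) : A i j = g (nth 0%N s i) j.
  by rewrite mxE (nth_map 0%N) ?sm.
have detU : \det U = 2 ^+ m.
  rewrite -det_tr det_trig.
    rewrite (eq_bigr (fun=> 2)) ?prodr_const ?card_ord // => i _.
    by rewrite !mxE eqxx gtn_eqF ?mulr1 ?addr0.
  apply/is_trig_mxP => i j ij; rewrite !mxE -val_eqE /=.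
  by rewrite !gtn_eqF ?mulr0 // (ltn_trans ij).
rewrite -detU mulrC -det_mulmx; congr (\det _); apply/matrixP => i j.
rewrite mxE (nth_map 0%N) ?sm // mxE.
under eq_bigr => k _ do rewrite (mxE _ _ k j) mulrDr.
rewrite big_split /=; congr (_ + _).
  rewrite (bigD1 j) //= eqxx mulr1 AE mulrC big1 ?addr0 // => k /negbTE ->.
  by rewrite !mulr0.
case: j => [[|j] jm] /=.
  by rewrite big1 // => k _; rewrite mulr0.
rewrite (bigD1 (Ordinal (ltnW jm))) //= eqxx mulr1 AE big1 ?addr0 //.
move=> k; rewrite -val_eqE /= => kj.
by rewrite eqSS (negPf kj) mulr0.
Qed.

(** Pascal's rule makes each summand a difference of consecutive values of ['C(x - m, j.+1)], so the
    sum telescopes; [m <= a] keeps the truncated subtractions exact. *)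
Lemma sum_bin (m a b j : nat) : (m <= a <= b)%N ->
  (\sum_(a <= x < b) 'C(x - m, j)%:Z = 'C(b - m, j.+1)%:Z - 'C(a - m, j.+1)%:Z)%R.
Proof.
move=> /andP[ma ab].
rewrite (@telescope_sumr_eq _ a b (fun x => 'C(x - m, j.+1)%:Z)) // => i /andP[ai ib].
by rewrite subSn ?binS ?(leq_trans ma) //; lia.
Qed.

(** The entries are ['C(i, j)]: a lower triangular matrix with unit diagonal. *)
Lemma row_det_bin_iota (m d : nat) :
  row_det m [seq (fun j => 'C(x - d, j)%:Z) | x <- iota d m] = 1.
Proof.
rewrite /row_det det_trig.
  rewrite big1 // => i _.
  by rewrite mxE (nth_map 0%N) ?size_iota ?nth_iota // addKn binn.
apply/is_trig_mxP => i j ij.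
by rewrite mxE (nth_map 0%N) ?size_iota ?nth_iota // addKn bin_small.
Qed.

(** * Exact covers by an arbitrary family of tiles *)

Section Covers.
Local Open Scope fset_scope.
Local Open Scope ring_scope.
Variables (K : choiceType) (P : {fset K} -> Prop).

(** [is_tiling n] is the case [P = is_ribbon n]; leaving [P] free lets ribbons and blocks share the
    counting lemmas. *)
Definition is_cover (R : {fset K}) (T : {fset {fset K}}) :=
  [/\ forall A, A \in T -> P A,
      {in T &, forall A B, A != B -> [disjoint A & B]}
    & fcover T = R].

Definition covers (R : {fset K}) : {fset {fset {fset K}}} :=
  [fset T in fpowerset (fpowerset R) | `[< is_cover R T >]].

Lemma fcoverP (T : {fset {fset K}}) c :
  reflect (exists2 A, A \in T & c \in A) (c \in fcover T).
Proof.
apply: (iffP (bigfcupP _ _ _ _)) => [[A]|[A AT cA]]; last by exists A; rewrite ?AT.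
by rewrite andbT => AT cA; exists A.
Qed.

Lemma coversP R T : T \in covers R <-> is_cover R T.
Proof.
rewrite !inE /=; split=> [/andP[_ /asboolP]//|tT].
apply/andP; split; last exact/asboolP.
case: tT => _ _ <-; rewrite fpowersetE; apply/fsubsetP => A AT.
by rewrite fpowersetE; apply: bigfcup_sup.
Qed.

Lemma is_cover_sub R T A : is_cover R T -> A \in T -> A `<=` R.
Proof. by move=> [_ _ <-] AT; apply: bigfcup_sup. Qed.

Lemma is_cover_inj R T A B c :
  is_cover R T -> A \in T -> B \in T -> c \in A -> c \in B -> A = B.
Proof.
move=> [_ D _] AT BT cA cB; apply/eqP; apply: contraT => /(D _ _ AT BT).
by move=> /fdisjointP/(_ c cA); rewrite cB.
Qed.

Lemma is_coverD1 R T A : is_cover R T -> A \in T -> is_cover (R `\` A) (T `\ A).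
Proof.
move=> tT AT; case: (tT) => PT D covT; split.
- by move=> B; rewrite in_fsetD1 => /andP[_ /PT].
- by move=> B C; rewrite !in_fsetD1 => /andP[_ BT] /andP[_ CT]; apply: D.
- apply/fsetP => c; apply/fcoverP/fsetDP.
    move=> [B]; rewrite in_fsetD1 => /andP[BA BT] cB; split.
      by rewrite -covT; apply/fcoverP; exists B.
    by apply/negP => cA; rewrite (is_cover_inj tT AT BT cA cB) eqxx in BA.
  rewrite -covT => -[/fcoverP[B BT cB] cA]; exists B => //.
  by rewrite in_fsetD1 BT andbT; apply: contraNneq cA => <-.
Qed.

Lemma is_coverU1 R T A : P A -> A `<=` R -> is_cover (R `\` A) T ->
  is_cover R (A |` T).
Proof.
move=> PA AR tT; case: (tT) => PT D covT.
have dA B : B \in T -> [disjoint A & B].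
  move=> /(is_cover_sub tT)/fsubsetP BR; apply/fdisjointP => c cA.
  by apply/negP => /BR; rewrite inE cA.
split.
- by move=> B /fset1UP[->|/PT].
- move=> B C /fset1UP[->|BT] /fset1UP[->|CT]; rewrite ?eqxx //; last exact: D.
    by move=> _; apply: dA.
  by move=> _; rewrite fdisjoint_sym; apply: dA.
- apply/fsetP => c; apply/fcoverP/idP.
    move=> [B /fset1UP[->|BT] cB]; first exact: (fsubsetP AR).
    have := is_cover_sub tT BT => /fsubsetP/(_ c cB).
    by rewrite inE => /andP[].
  move=> cR; have [cA|cA] := boolP (c \in A).
    by exists A; rewrite ?fset1U1.
  have : c \in R `\` A by rewrite inE cA.
  rewrite -covT => /fcoverP[B BT cB]; exists B => //.
  by rewrite in_fset1U BT orbT.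
Qed.

Definition covers_with (R A : {fset K}) := [fset T in covers R | A \in T].

Lemma in_covers_with R A T :
  (T \in covers_with R A) = (T \in covers R) && (A \in T).
Proof. by rewrite in_fset. Qed.

(** Removing and adding [A] are inverse bijections. The witness [c] makes [A] nonempty, so that [A]
    is never already a tile of a cover of its complement. *)
Lemma card_covers_with R A c : P A -> c \in A ->
  #|` covers_with R A| =
  if A `<=` R then #|` covers (R `\` A)| else 0%N.
Proof.
move=> PA cA; case: ifPn => [AR|AR]; last first.
  apply/eqP; rewrite cardfs_eq0; apply/eqP/fsetP => T; rewrite in_covers_with in_fset0.
  apply/negP => /andP[/coversP tT AT].
  by rewrite (is_cover_sub tT AT) in AR.
have notin T : is_cover (R `\` A) T -> A \notin T.
  move=> tT; apply/negP => /(is_cover_sub tT)/fsubsetP/(_ c cA).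
  by rewrite inE cA.
transitivity #|` [fset A |` T | T in covers (R `\` A)]|; last first.
  rewrite card_in_imfset // => T U tT tU eTU.
  have AT := notin T ((coversP _ _).1 tT); have AU := notin U ((coversP _ _).1 tU).
  by rewrite -(fsetU1K AT) eTU fsetU1K.
congr #|` _|; apply/fsetP => T; rewrite in_covers_with; apply/idP/imfsetP.
  move=> /andP[/coversP tT AT]; exists (T `\ A); last by rewrite fsetD1K.
  exact/coversP/is_coverD1.
move=> [U /coversP tU ->]; rewrite fset1U1 andbT.
exact/coversP/is_coverU1.
Qed.

Lemma card_covers_one R A c : c \in R -> P A -> c \in A ->
  (forall B, P B -> c \in B -> B `<=` R -> B = A) ->
  #|` covers R| = if A `<=` R then #|` covers (R `\` A)| else 0%N.
Proof.
move=> cR PA cA only; rewrite -(card_covers_with R PA cA); congr #|` _|.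
apply/fsetP => T; rewrite (in_covers_with R A).
case: (boolP (T \in covers R)) => //= /coversP tT.
move: cR; case: (tT) => PT _ {1}<- /fcoverP[B BT cB].
by rewrite -(only B (PT _ BT) cB (is_cover_sub tT BT)) BT.
Qed.

(** Splits the covers by the tile containing [c]; no cover contains both candidates, since they are
    distinct and overlap at [c]. *)
Lemma card_covers_two R A1 A2 c : c \in R -> A1 != A2 ->
  P A1 -> P A2 -> c \in A1 -> c \in A2 ->
  (forall A, P A -> c \in A -> A `<=` R -> A = A1 \/ A = A2) ->
  #|` covers R| = ((if A1 `<=` R then #|` covers (R `\` A1)| else 0) +
                   (if A2 `<=` R then #|` covers (R `\` A2)| else 0))%N.
Proof.
move=> cR A12 P1 P2 c1 c2 only.
rewrite -(card_covers_with R P1 c1) -(card_covers_with R P2 c2).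
set X := covers_with R A1; set Y := covers_with R A2.
have <- : X `|` Y = covers R.
  apply/fsetP => T; rewrite in_fsetU.
  rewrite (in_covers_with R A1) (in_covers_with R A2) -andb_orr.
  case: (boolP (T \in covers R)) => //= /coversP tT.
  move: cR; case: (tT) => PT _ {1}<- /fcoverP[A AT cA].
  case: (only A (PT _ AT) cA (is_cover_sub tT AT)) => <-; by rewrite AT ?orbT.
rewrite cardfsU (_ : X `&` Y = fset0) ?cardfs0 ?subn0 //.
apply/fsetP => T; rewrite in_fsetI (in_covers_with R A1) (in_covers_with R A2).
rewrite in_fset0; apply/negP.
move=> /andP[/andP[/coversP tT A1T] /andP[_ A2T]].
by rewrite (is_cover_inj tT A1T A2T c1 c2) eqxx in A12.
Qed.

Lemma card_covers0 : (forall A, P A -> A != fset0) -> #|` covers fset0| = 1%N.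
Proof.
move=> ne; rewrite (_ : covers fset0 = [fset fset0]) ?cardfs1 //.
apply/fsetP => T; rewrite in_fset1; apply/idP/eqP.
  move=> /coversP tT; apply/fsetP => A; rewrite in_fset0; apply/negP => AT.
  have := is_cover_sub tT AT; rewrite fsubset0.
  by case: tT => /(_ _ AT)/ne/negPf ->.
move=> ->; apply/coversP; split => [A|A B|]; rewrite ?in_fset0 //.
by apply/fsetP => c; rewrite in_fset0; apply/fcoverP => -[A]; rewrite in_fset0.
Qed.

End Covers.

(** * Reduction of ribbon tilings to domino tilings *)

Section Blocks.
Local Open Scope fset_scope.
Local Open Scope ring_scope.
Let o : cell := (0, 0).
Variables n k : nat.
Hypothesis hkn : (k.+2 <= n)%N.

(* A square is located by its column [x] and its level [l], normalised so that the
   bottom squares of the left columns have level 0.  The levels are grouped into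
   bands: band [2q] consists of the levels [nq .. nq+k] and band [2q+1] of the
   levels [nq+k+1 .. nq+n-1]. *)
Definition band (l : nat) : nat := ((l %/ n).*2 + (k < l %% n))%N.

Definition band_start (h : nat) : nat := (n * h./2 + odd h * k.+1)%N.

Lemma band_startSS h : band_start h.+2 = (band_start h + n)%N.
Proof. by rewrite /band_start /= negbK; lia. Qed.

(** Even bands have [k + 1] levels and odd ones [n - k - 1], which is positive because
    [k + 2 <= n]. *)
Lemma ltn_band_startS h : (band_start h < band_start h.+1)%N.
Proof.
have [m] := ubnP h; elim: m h => // m IH [|[|h]] hm.
- by rewrite /band_start /= muln0 mul1n.
- by rewrite /band_start /= muln0 mul1n muln1 addn0.
- by rewrite !band_startSS ltn_add2r IH // -ltnS ltnW.
Qed.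

Lemma leq_band_start g h : (g <= h)%N -> (band_start g <= band_start h)%N.
Proof.
move=> /subnKC <-; elim: (h - g)%N => [|d IH]; first by rewrite addn0.
by rewrite addnS (leq_trans IH) // ltnW ?ltn_band_startS.
Qed.

Lemma band_bounds l : (band_start (band l) <= l < band_start (band l).+1)%N.
Proof.
rewrite {2 3}(divn_eq l n) /band; have := @ltn_pmod l n; set q := (l %/ n)%N.
set r := (l %% n)%N => rn; have {}rn : (r < n)%N by apply: rn; lia.
rewrite /band_start /=; case: ltnP => kr; rewrite ?addn0 ?addn1 /=;
  rewrite ?uphalf_double ?doubleK ?odd_double /=; lia.
Qed.

Lemma bandE l h : (band l == h) = (band_start h <= l < band_start h.+1)%N.
Proof.
apply/eqP/idP => [<-|/andP[hl lh]]; first exact: band_bounds.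
have /andP[hl' lh'] := band_bounds l.
case: (ltngtP (band l) h) => // /leq_band_start; lia.
Qed.

Lemma band_startK h : band (band_start h) = h.
Proof. by apply/eqP; rewrite bandE leqnn ltn_band_startS. Qed.

Lemma bandDn l : band (l + n) = (band l).+2.
Proof.
apply/eqP; rewrite bandE -addn2 -addSn addn2 !band_startSS.
by rewrite leq_add2r ltn_add2r band_bounds.
Qed.

(** Only squares with nonnegative column and level are reached, hence the clauses [exists x l] in
    what follows. *)
Definition square_at (x l : nat) : cell := (x%:Z, l%:Z - 1 - x%:Z).

Lemma square_at_inj x l x' l' : square_at x l = square_at x' l' -> x = x' /\ l = l'.
Proof. by rewrite /square_at => -[]; lia. Qed.

(* A pair [(h, x)] stands for the vertical segment of squares of column [x] with
   level in band [h]. *)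
Definition blow_up (R : {fset nat * nat}) : {fset cell} :=
  \bigcup_(c <- R) [fset square_at c.2 l | l in
    iota (band_start c.1) (band_start c.1.+1 - band_start c.1)].

Lemma in_blow_up R x l : (square_at x l \in blow_up R) = ((band l, x) \in R).
Proof.
apply/bigfcupP/idP => [[[h y]]|lR]; rewrite ?andbT /=.
  move=> hR /imfsetP[l' /= l'h /square_at_inj[-> ->]].
  suff /eqP -> : band l' == h by [].
  by move: l'h; rewrite bandE mem_iota subnKC // ltnW ?ltn_band_startS.
exists (band l, x); rewrite ?lR //; apply/imfsetP; exists l => //=.
by rewrite mem_iota subnKC ?band_bounds // ltnW ?ltn_band_startS.
Qed.

Lemma blow_up_square R c : c \in blow_up R -> exists x l, c = square_at x l.
Proof. by move=> /bigfcupP[[h x] _ /imfsetP[l _ ->]]; exists x, l. Qed.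

Lemma eq_blow_up R (A : {fset cell}) :
  (forall c, c \in A -> exists x l, c = square_at x l) ->
  (forall x l, (square_at x l \in A) = ((band l, x) \in R)) -> A = blow_up R.
Proof.
move=> Apt AR; apply/fsetP => c; apply/idP/idP => cA.
  by have [x [l e]] := Apt c cA; move: cA; rewrite e in_blow_up AR.
by have [x [l e]] := blow_up_square cA; move: cA; rewrite e in_blow_up AR.
Qed.

(** The flag [e] records whether the ribbon turns right on entering band [h + 1]. *)
Definition domino (h x : nat) (e : bool) : {fset nat * nat} :=
  [fset (h, x); (h.+1, (x + e)%N)].

Definition block_tile (A : {fset cell}) : Prop :=
  exists h x e, A = blow_up (domino h x e).

(** Each step of a ribbon raises the level by one, so a ribbon is the graph of a function from [n]
    consecutive levels to columns. *)
Lemma in_ribbon A R : is_ribbon n A -> A `<=` blow_up R ->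
  exists l0 f, (forall i, (i.+1 < n)%N -> exists e : bool, f i.+1 = (f i + e)%N) /\
    (forall x l, (square_at x l \in A) = (l0 <= l < l0 + n)%N && (x == f (l - l0)%N)).
Proof.
move=> [s [sn srt ->]] /fsubsetP sub.
have n0 : (0 < n)%N by apply: leq_trans hkn.
have pts i : (i < n)%N -> exists x l, nth o s i = square_at x l.
  by move=> i_n; apply: (@blow_up_square R); apply: sub; rewrite inE mem_nth ?sn.
have [x0 [l0 e0]] := pts 0%N n0.
pose f i := `|(nth o s i).1|%N.
have step i : (i.+1 < n)%N -> ribbon_step (nth o s i) (nth o s i.+1).
  by move=> i_n; move/sortedP : srt; apply; rewrite sn.
have key i : (i < n)%N -> nth o s i = square_at (f i) (l0 + i).
  elim: i => [|i IH] i_n; first by rewrite addn0 /f e0.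
  have := step i i_n; rewrite (IH (ltnW i_n)) /f.
  have [x [l ->]] := pts _ i_n.
  rewrite /ribbon_step /square_at /= => /orP[] /eqP []; move=> a b; congr (_, _); lia.
exists l0, f; split.
  move=> i i_n; have := step i i_n; rewrite !key ?(ltnW i_n) //.
  rewrite /ribbon_step /square_at /= => /orP[] /eqP [] a b.
    by exists false; lia.
  by exists true; lia.
move=> x l; rewrite inE; apply/idP/andP.
  move=> /(nthP o)[i]; rewrite sn => i_n; rewrite key // => /square_at_inj[<- <-].
  by rewrite leq_addr ltn_add2l i_n addKn eqxx.
move=> [/andP[l1 l2] /eqP ->]; apply/(nthP o); exists (l - l0)%N.
  by rewrite sn; lia.
by rewrite key ?subnKC //; lia.
Qed.

Lemma block_tile_ribbon A : block_tile A -> is_ribbon n A.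
Proof.
move=> [h [x [e ->]]].
pose f i := if (band_start h + i < band_start h.+1)%N then x else (x + e)%N.
exists [seq square_at (f i) (band_start h + i) | i <- iota 0 n]; split.
- by rewrite size_map size_iota.
- apply/(sortedP o) => i; rewrite size_map size_iota => i_n.
  have i_n' := ltnW i_n.
  rewrite !(nth_map 0%N) ?size_iota // !nth_iota // !add0n.
  rewrite /ribbon_step /square_at /f /= !xpair_eqE.
  by do 2 case: ltnP => ?; case: (e) => /=; lia.
- symmetry; apply: eq_blow_up => [c|y l].
    by rewrite inE => /mapP[i _ ->]; exists (f i), (band_start h + i)%N.
  rewrite /domino !inE !xpair_eqE !bandE band_startSS.
  have := ltn_band_startS h; have := ltn_band_startS h.+1; rewrite band_startSS => b1 b2.
  apply/mapP/idP.
    move=> [i]; rewrite mem_iota => /andP[_ i_n] /square_at_inj[-> ->].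
    by rewrite /f; case: ltnP => ?; lia.
  move=> H; exists (l - band_start h)%N; first by rewrite mem_iota; lia.
  by rewrite /f subnKC; last lia; case: ltnP => ?; congr square_at; lia.
Qed.

Section Structure.
Variables (R : {fset nat * nat}) (T : {fset {fset cell}}).
Hypothesis tT : is_cover (is_ribbon n) (blow_up R) T.

Let vertical l := forall x A, band l = band l.+1 -> A \in T ->
  square_at x l \in A -> square_at x l.+1 \in A.

Lemma tile_shape A : A \in T ->
  exists l0 f, (forall i, (i.+1 < n)%N -> exists e : bool, f i.+1 = (f i + e)%N) /\
    (forall x l, (square_at x l \in A) = (l0 <= l < l0 + n)%N && (x == f (l - l0)%N)).
Proof.
move=> AT; apply: (@in_ribbon A R); first by case: tT => /(_ _ AT).
exact: is_cover_sub tT AT.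
Qed.

Lemma tile_at x l : (band l, x) \in R -> exists2 A, A \in T & square_at x l \in A.
Proof. by rewrite -in_blow_up; case: tT => _ _ <- /fcoverP. Qed.

Lemma tile_in A x l : A \in T -> square_at x l \in A -> (band l, x) \in R.
Proof. by rewrite -in_blow_up => /(is_cover_sub tT)/fsubsetP; apply. Qed.

(** The region consists of whole band segments, so the square below is covered by some tile; that
    tile goes up, hence it is [A]. *)
Lemma vertical_down l x A : vertical l -> band l = band l.+1 -> A \in T ->
  square_at x l.+1 \in A -> square_at x l \in A.
Proof.
move=> V ll AT xA; have := tile_in AT xA; rewrite -ll => /tile_at[B BT xB].
by rewrite (is_cover_inj tT AT BT xA (V _ _ ll BT xB)).
Qed.

(* Suppose the tile of [(x, l)] does not go up within its band.  If it goes right,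
   then the tile of [(x+1, l)] must go right too (downward induction on [x]).  If it ends
   at level [l], then its first square, at level [l-n+1], is not the first of its
   band, and the square below it lies in a tile that goes straight up (induction
   on [l]). *)
Lemma verticalP l : vertical l.
Proof.
elim/ltn_ind: l => l IHl x A ll AT xA.
pose B := (\max_(c <- R) c.2).+1.
have leB h y : (h, y) \in R -> (y < B)%N.
  by move=> hR; rewrite ltnS (leq_bigmax_seq (F := fun c => c.2) (h, y)).
have [m] := ubnP (B - x); elim: m => // m IHm in x A AT xA *; rewrite ltnS => Bm.
have [l0 [f [fS memA]]] := tile_shape AT.
have := xA; rewrite memA => /andP[/andP[l0l ln] /eqP xE].
have [l1n|] := ltnP l.+1 (l0 + n).
  have [|e fE] := fS (l - l0)%N; first by lia.
  have xA' : square_at (x + e) l.+1 \in A.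
    by rewrite memA xE -fE -subSn // eqxx l1n (leq_trans l0l) //.
  case: e {fE} xA' => [|]; last by rewrite addn0.
  rewrite addn1 => xA'.
  have xR := tile_in AT xA'; have xB := leB _ _ xR; move: xR.
  rewrite -ll => /tile_at[C CT xC].
  have xC' : square_at x.+1 l.+1 \in C by apply: IHm => //; lia.
  have CA := is_cover_inj tT AT CT xA' xC'.
  by move: xC; rewrite -CA memA -xE => /andP[_ /eqP]; lia.
move=> nl; have {nl ln} lE : (l.+1 = l0 + n)%N by lia.
(* A tile starting at level 0 ends at level [n - 1], the last one of band 1, while level [n] opens
   band 2. *)
case: l0 => [|l2] in l0l memA xE lE *.
  have := band_bounds l; rewrite ll lE add0n.
  have -> : n = band_start 2 by rewrite /band_start /= muln1 addn0.
  by rewrite band_startK /band_start /= muln1; lia.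
have {}lE : l = (l2 + n)%N by lia.
have l2E : band l2 = band l2.+1.
  by move: ll; rewrite lE -addSn !bandDn => -[].
have : square_at (f 0%N) l2.+1 \in A by rewrite memA subnn eqxx leqnn /=; lia.
have l2l : (l2 < l)%N by lia.
by move=> /(vertical_down (IHl l2 l2l) l2E AT); rewrite memA ltnn.
Qed.

(** A tile starting inside a band would also contain the square below its first one. So it starts
    with a band, fills two consecutive bands, and is vertical in each. *)
Lemma tile_is_block A : A \in T -> block_tile A.
Proof.
move=> AT; have [l0 [f [fS memA]]] := tile_shape AT.
have n0 : (0 < n)%N by apply: leq_trans hkn.
have down l x : band l = band l.+1 -> square_at x l.+1 \in A -> square_at x l \in A.
  by move=> ll; apply: vertical_down => //; apply: verticalP.
have /andP[] := band_bounds l0; set h := band l0; clearbody h => hl lh.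
have l0E : l0 = band_start h.
  apply/eqP; rewrite eqn_leq hl andbT leqNgt; apply/negP => hl0.
  case: l0 => [|l] in memA hl lh hl0 *; first by [].
  have e1 : band l = h by apply/eqP; rewrite bandE; lia.
  have e2 : band l.+1 = h by apply/eqP; rewrite bandE; lia.
  have ll : band l = band l.+1 by rewrite e1 e2.
  by have := down l (f 0%N) ll; rewrite !memA subnn eqxx !leqnn ltnn /=; lia.
have b1 := ltn_band_startS h; have b2 := ltn_band_startS h.+1; rewrite band_startSS in b2.
(* [d] is the index of the first square in band [h + 1], the only place where the column can
   change. *)
pose d := (band_start h.+1 - band_start h)%N.
have const i : (i.+1 < n)%N -> band (l0 + i) = band (l0 + i).+1 -> f i.+1 = f i.
  move=> i_n ll; have := down _ (f i.+1) ll; rewrite !memA -addnS !addKn eqxx.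
  by move=> H; apply/eqP; move: H; lia.
have f1 i : (i < d)%N -> f i = f 0%N.
  elim: i => // i IH id; rewrite -IH ?(ltnW id) //; apply: const; first lia.
  have -> : band (l0 + i) = h by apply/eqP; rewrite bandE; lia.
  by apply/esym/eqP; rewrite bandE; lia.
have f2 i : (d + i < n)%N -> f (d + i)%N = f d.
  elim: i => [|i IH] id; first by rewrite addn0.
  rewrite addnS const ?IH //; try lia.
  have -> : band (l0 + (d + i)) = h.+1 by apply/eqP; rewrite bandE band_startSS; lia.
  by apply/esym/eqP; rewrite bandE band_startSS; lia.
have [|e fd] := fS d.-1; first by lia.
rewrite prednK in fd; last by lia.
rewrite (f1 d.-1) in fd; last by lia.
exists h, (f 0%N), e; apply: eq_blow_up => [c cA|x l].
  have /fsubsetP/(_ _ cA) := is_cover_sub tT AT.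
  exact: blow_up_square.
rewrite memA /domino !inE !xpair_eqE !bandE band_startSS -fd l0E.
have [lb|lb] := ltnP l (band_start h.+1).
  have [le|gt] /= := leqP (band_start h) l; last by lia.
  by rewrite f1; lia.
have [le|gt] /= := leqP (band_start h) l; last by lia.
have [lt|ge] /= := ltnP l (band_start h + n); last by lia.
by have -> : (l - band_start h = d + (l - band_start h.+1))%N; [lia|rewrite f2; lia].
Qed.

End Structure.

Lemma tilings_blow_up R : tilings n (blow_up R) = covers block_tile (blow_up R).
Proof.
apply/fsetP => T; apply/idP/idP.
  move=> /tilingsP tT; apply/coversP; case: (tT) => _ D cT; split => // A AT.
  exact: tile_is_block tT _ AT.
move=> /coversP [PT D cT]; apply/tilingsP; split => // A /PT.
exact: block_tile_ribbon.
Qed.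

End Blocks.

(** * Removal of the top band of a domino region *)

Section Peeling.
Local Open Scope fset_scope.
Local Open Scope ring_scope.
Variables n k N : nat.
Hypothesis hkn : (k.+2 <= n)%N.
Local Notation blow_up := (blow_up n k).
Local Notation band := (band n k).
Local Notation band_start := (band_start n k).

Lemma blow_up_sub (D R : {fset nat * nat}) : (blow_up D `<=` blow_up R) = (D `<=` R).
Proof.
apply/fsubsetP/fsubsetP => [sub [h x] hD|sub c cD].
  have := sub (square_at x (band_start h)).
  by rewrite !(in_blow_up hkn) band_startK //; apply.
have [x [l e]] := blow_up_square cD; move: cD; rewrite e !(in_blow_up hkn); exact: sub.
Qed.

Lemma blow_upD (D R : {fset nat * nat}) : blow_up R `\` blow_up D = blow_up (R `\` D).
Proof.
apply: eq_blow_up => // [c|x l]; last by rewrite !inE !in_blow_up.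
by rewrite inE => /andP[_]; apply: blow_up_square.
Qed.

Lemma blow_up_inj : injective blow_up.
Proof.
by move=> D R e; apply/eqP; rewrite eqEfsubset -!blow_up_sub e fsubset_refl.
Qed.

(** The rows of the usual Aztec diamond, slanted because positions are columns: the left end
    advances by one every two bands. *)
Definition band_row (h : nat) : seq nat := iota h./2 (N + odd h).

(* All the bands below [h], together with the parts [P] of band [h] and [Q] of
   band [h+1]. *)
Definition region (h : nat) (P Q : seq nat) : {fset nat * nat} :=
  [fset c in [seq (g, x) | g <- iota 0 h, x <- band_row g] ++
             [seq (h, x) | x <- P] ++ [seq (h.+1, x) | x <- Q]].

Lemma in_region h P Q g x : ((g, x) \in region h P Q) =
  [|| (g < h)%N && (x \in band_row g), (g == h) && (x \in P) | (g == h.+1) && (x \in Q)].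
Proof.
rewrite in_fset !mem_cat; congr [|| _, _ | _].
- apply/allpairsPdep/andP => [[g' [x' [gh xr [-> ->]]]]|[gh xr]].
    by move: gh; rewrite mem_iota.
  by exists g, x; rewrite mem_iota.
- by apply/mapP/andP => [[y yP [-> ->]]|[/eqP -> xP]]; [rewrite eqxx|exists x].
- by apply/mapP/andP => [[y yP [-> ->]]|[/eqP -> xP]]; [rewrite eqxx|exists x].
Qed.

Definition ncovers (h : nat) (P Q : seq nat) : nat :=
  #|` covers (block_tile n k) (blow_up (region h P Q))|.

Lemma eq_ncovers h P Q P' Q' : P =i P' -> Q =i Q' -> ncovers h P Q = ncovers h P' Q'.
Proof.
move=> eP eQ; congr #|` covers _ (blow_up _)|.
by apply/fsetP => -[g x]; rewrite !in_region eP eQ.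
Qed.

Lemma ncovers_top h P : ncovers h.+1 P [::] = ncovers h (band_row h) P.
Proof.
congr #|` covers _ (blow_up _)|; apply/fsetP => -[g x]; rewrite !in_region.
rewrite in_nil andbF orbF ltnS leq_eqVlt.
by have [->|_] //= := eqVneq g h; rewrite ltnn.
Qed.

Lemma ncovers0 : ncovers 0 [::] [::] = 1%N.
Proof.
rewrite /ncovers (_ : blow_up _ = fset0).
  apply: card_covers0 => A [h [x [e ->]]]; apply/fset0Pn.
  by exists (square_at x (band_start h)); rewrite in_blow_up // band_startK // !inE eqxx.
apply/fsetP => c; rewrite in_fset0; apply/negP => cR.
have [x [l e]] := blow_up_square cR; move: cR.
by rewrite e (in_blow_up hkn) in_region !in_nil !andbF.
Qed.

Lemma region_minus h P Q y z : y \notin Q ->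
  region h P (y :: Q) `\` [fset (h, z); (h.+1, y)] =
  region h [seq x <- P | x != z] Q.
Proof.
move=> yQ; apply/fsetP => -[g x].
rewrite in_fsetD !in_region !inE !xpair_eqE mem_filter.
have [->|gh] /= := eqVneq g h.
  by rewrite ltnn /= (ltn_eqF (ltnSn h)) /= !orbF.
have [->|gh1] /= := eqVneq g h.+1; last by rewrite !orbF.
rewrite ltnNge leqnSn /=; case: eqVneq => //= ->.
by rewrite (negPf yQ).
Qed.

Lemma domino_sub h P Q y z (e : bool) : (z + e)%N = y ->
  (domino h z e `<=` region h P (y :: Q)) = (z \in P).
Proof.
move=> zy; rewrite /domino fsubUset !fsub1set zy !in_region !eqxx ltnn /=.
by rewrite (ltn_eqF (ltnSn h)) (gtn_eqF (ltnSn h)) ltnNge leqnSn /= orbF mem_head andbT.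
Qed.

(** Nothing lies above band [h + 1], so the square [y] is the upper half of its domino, whose lower
    half is at [y] or [y - 1]. *)
Lemma ncovers_cons h P y Q : y \notin Q ->
  ncovers h P (y :: Q) =
    ((if y \in P then ncovers h [seq x <- P | x != y] Q else 0) +
     (if (0 < y) && (y.-1 \in P) then ncovers h [seq x <- P | x != y.-1] Q else 0))%N.
Proof.
move=> yQ; set c := square_at y (band_start h.+1).
have cP D : (c \in blow_up D) = ((h.+1, y) \in D) by rewrite in_blow_up // band_startK.
have cR : c \in blow_up (region h P (y :: Q)).
  by rewrite cP in_region inE !eqxx /= !orbT.
pose A1 := blow_up (domino h y false); pose A2 := blow_up (domino h y.-1 true).
have P1 : block_tile n k A1 by exists h, y, false.
have P2 : block_tile n k A2 by exists h, y.-1, true.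
have c1 : c \in A1 by rewrite cP !inE addn0 eqxx orbT.
have only A : block_tile n k A -> c \in A -> A `<=` blow_up (region h P (y :: Q)) ->
    A = A1 \/ ((0 < y)%N /\ A = A2).
  move=> [g [x [e ->]]]; rewrite cP blow_up_sub // !inE !xpair_eqE.
  move=> /orP[/andP[/eqP gh /eqP yx]|].
    rewrite /domino -gh fsubUset !fsub1set => /andP[_].
    by rewrite in_region; lia.
  rewrite eqSS => /andP[/eqP <- /eqP yE] _; rewrite /A1 /A2 yE.
  by case: e {yE} => /=; [right; rewrite addn1|left; rewrite addn0].
have minus z (e : bool) : (z + e)%N = y ->
    blow_up (region h P (y :: Q)) `\` blow_up (domino h z e) =
    blow_up (region h [seq x <- P | x != z] Q).
  by move=> zy; rewrite blow_upD /domino zy region_minus.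
(* For [y = 0] only the straight domino exists; [y.-1] would be 0 again. *)
have [y0|y0] := posnP y.
  rewrite addn0 /ncovers (card_covers_one cR P1 c1) => [|B PB cB /(only _ PB cB)].
    by rewrite blow_up_sub // domino_sub ?minus ?addn0.
  by case=> // -[]; rewrite y0.
have c2 : c \in A2 by rewrite cP !inE addn1 prednK // eqxx orbT.
rewrite /ncovers (card_covers_two cR _ P1 P2 c1 c2).
- by rewrite !blow_up_sub // !domino_sub ?minus ?addn0 ?addn1 ?prednK.
- apply/eqP => /blow_up_inj/fsetP/(_ (h, y)); rewrite !inE !xpair_eqE eqxx /=.
  by rewrite (ltn_eqF (ltnSn h)) /= orbF; lia.
- by move=> A PA cA /(only _ PA cA) [|[_]]; [left|right].
Qed.

Definition notin_from (x M : nat) (S : seq nat) : seq nat :=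
  [seq y <- iota x (M.+1 - x) | y \notin S].

Lemma mem_notin_from x M S y : (y \in notin_from x M S) = (x <= y <= M)%N && (y \notin S).
Proof. by rewrite mem_filter mem_iota andbC; congr andb; lia. Qed.

Lemma notin_fromS x M S : (x <= M)%N -> x \notin S ->
  notin_from x M S = x :: notin_from x.+1 M S.
Proof. by move=> xM xS; rewrite /notin_from subSn //= xS subSS. Qed.

Lemma notin_from_mem x M S : (x <= M)%N -> (forall y, y \in S -> (x < y)%N) ->
  notin_from x M (x :: S) =i notin_from x.+1 M S.
Proof.
by move=> xM Sx y; rewrite !mem_notin_from inE; case: eqVneq => [->|] /=; lia.
Qed.

Lemma ncovers_notin_from h P x M S :
  (x <= M)%N -> x \notin S ->
  ncovers h P (notin_from x M S) =
    ((if x \in P then ncovers h [seq z <- P | z != x] (notin_from x.+1 M S) else 0) +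
     (if (0 < x) && (x.-1 \in P) then
       ncovers h [seq z <- P | z != x.-1] (notin_from x.+1 M S) else 0))%N.
Proof.
move=> xM xS; rewrite notin_fromS // ncovers_cons //.
by rewrite mem_notin_from ltnn.
Qed.

(** * From an even band to the odd band above it *)

Section Interlacing.
Variables (h lo M m : nat) (c : int) (e : nat -> nat -> int).
Hypothesis He : forall u, pairwise ltn u -> size u = m ->
  (forall y, y \in u -> (lo <= y < M)%N) -> 
  (ncovers h u [::])%:Z = c * row_det m (map e u).

(** By multilinearity, this row accounts for all choices of an unmatched square [t] with
    [a <= t < b]. *)
Let gap (a b j : nat) : int := \sum_(a <= x < b) e x j.

(* The squares [y] of the upper band outside [S] are matched with [y] or [y-1] in
   the lower band, from left to right.  The elements of [u] are the lower squares
   left unmatched for good.  In state [blocked] the lower square [x-1] is used and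
   the squares [y >= x] remain to be matched; in state [free] the square [x] is
   unused and the squares [y >= x+1] remain. *)
Let blocked x u S :=
  ncovers h (u ++ iota x (M - x)) (notin_from x M S).

Let free x u S :=
  ncovers h (u ++ iota x (M - x)) (notin_from x.+1 M S).

(** Each upper square [y] is forced onto the lower square [y], and the last one, [M], finds none:
    the lower band stops at [M - 1]. *)
Lemma blocked_nil x u : (x <= M)%N -> (forall y, y \in u -> (y.+1 < x)%N) ->
  blocked x u [::] = 0%N.
Proof.
move=> xM; have [d] := ubnP (M - x); elim: d => // d IH in x xM * => dx ux.
rewrite /blocked ncovers_notin_from //.
rewrite [X in (_ + X)%N]ifF ?addn0; last first.
  rewrite mem_cat mem_iota; apply/negP => /andP[x0 /orP[/ux|]]; lia.
case: ifP => // xP.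
have xM' : (x < M)%N.
  by move: xP; rewrite mem_cat mem_iota => /orP[/ux|]; lia.
rewrite -[RHS](IH x.+1) //; try lia; last by move=> y /ux; lia.
apply: eq_ncovers => // y; rewrite mem_filter !mem_cat !mem_iota.
by case: (boolP (y \in u)) => [/ux|]; lia.
Qed.

(** Up to [s] every upper square is forced onto the lower square of the same position; at [s]
    nothing is to be matched, and the lower square [s] becomes free. The premise is [freeP] for
    positions from [x] on, so that the lemma can serve inside the induction proving [freeP]. *)
Lemma blocked_of_free x :
  (forall x' u S, (x <= x' <= M)%N -> pairwise ltn u ->
    (forall y, y \in u -> (lo <= y < x')%N) -> pairwise ltn S ->
    (forall y, y \in S -> (x' < y <= M)%N) -> (size u + size S = m)%N ->
    (free x' u S)%:Z = c * row_det m (map e u ++ pairmap gap x' S)) ->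
  forall u s S, pairwise ltn u -> (forall y, y \in u -> (lo <= y)%N && (y.+1 < x)%N) ->
  pairwise ltn (s :: S) ->
  (forall y, y \in s :: S -> (x <= y <= M)%N) -> (size u + size S = m)%N ->
  (blocked x u (s :: S))%:Z = c * row_det m (map e u ++ pairmap gap s S).
Proof.
move=> F u s S pu ux pS Sx sz.
have := Sx s; rewrite inE eqxx => /(_ isT) /andP[xs sM].
have [d] := ubnP (s - x); elim: d => // d IH in x F ux xs Sx * => dx.
have [sx|sx] := eqVneq s x.
  move: pS => /= /andP[/allP sS pS].
  subst x; rewrite -(F s) ?leqnn ?sM //.
  - congr Posz; rewrite /blocked /free; apply: eq_ncovers => //.
    exact: notin_from_mem.
  - by move=> y /ux; lia.
  - move=> y yS; have /= := sS y yS; have := Sx y.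
    by rewrite inE yS orbT => /(_ isT); lia.
have xS : x \notin s :: S.
  move: pS => /= /andP[/allP sS pS].
  by rewrite inE negb_or eq_sym sx /=; apply/negP => /sS /=; lia.
rewrite /blocked ncovers_notin_from //; last lia.
rewrite [X in (_ + X)%N]ifF ?addn0; last first.
  rewrite mem_cat mem_iota; apply/negP => /andP[x0 /orP[/ux|]]; lia.
rewrite ifT; last by rewrite mem_cat mem_iota; apply/orP; right; lia.
rewrite -(IH x.+1).
- congr Posz; apply: eq_ncovers => // y; rewrite mem_filter !mem_cat !mem_iota.
  by case: (boolP (y \in u)) => [/ux|]; lia.
- by move=> x' u' S' x'M; apply: F; lia.
- by move=> y /ux; lia.
- lia.
- move=> y yS; have := Sx y yS; case: (eqVneq x y) => [xy|]; last lia.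
  by move: xS; rewrite xy yS.
- lia.
Qed.

(** Downward induction on [x]: the free square [x] is either left unmatched or taken by the upper
    square [x + 1], mirroring the splitting of the first gap row into [e x] and the gap from
    [x + 1]. *)
Lemma freeP x u S : (lo <= x <= M)%N -> pairwise ltn u ->
  (forall y, y \in u -> (lo <= y < x)%N) -> pairwise ltn S ->
  (forall y, y \in S -> (x < y <= M)%N) -> (size u + size S = m)%N ->
  (free x u S)%:Z = c * row_det m (map e u ++ pairmap gap x S).
Proof.
have [d] := ubnP (M - x); elim: d => // d IH in x u S * => dx.
move=> /andP[lox xM] pu ux pS Sx sz.
have pux : pairwise ltn (rcons u x).
  by rewrite pairwise_rcons pu andbT; apply/allP => y yu /=; have := ux y yu; lia.
have [eM|nM] := eqVneq x M.
  have S0 : S = [::].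
    by case: (S) Sx => // s S' /(_ s); rewrite inE eqxx => /(_ isT); lia.
  rewrite S0 /= cats0 -He //; first last.
  - by move=> y yu; have := ux y yu; rewrite eM.
  - by rewrite -sz S0 addn0.
  congr Posz; apply: eq_ncovers => y; first by rewrite eM subnn cats0.
  by rewrite mem_notin_from in_nil; lia.
have {}xM : (x < M)%N by lia.
(* If [x + 1] is in [S], no upper square is left to take [x], which joins [u]. *)
have [xS|xS] := boolP (x.+1 \in S).
  case: S => // s S in pS Sx sz xS *.
  have := Sx s; rewrite inE eqxx => /(_ isT) sx.
  move: pS => /= /andP[/allP sS pS].
  have {}sx : s = x.+1.
    by move: xS; rewrite inE => /orP[/eqP//|/sS] /=; lia.
  rewrite {}sx {s} in sS Sx sz xS *.
  have <- : e x = gap x x.+1 by apply/funext => j; rewrite /gap big_nat1.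
  rewrite -cat_rcons -map_rcons -(IH x.+1) //; first last.
  - by move: sz; rewrite size_rcons /=; lia.
  - move=> y yS; have /= := sS y yS; have := Sx y.
    by rewrite inE yS orbT => /(_ isT); lia.
  - by move=> y; rewrite mem_rcons inE => /orP[/eqP->|/ux]; lia.
  - lia.
  - lia.
  congr Posz; apply: eq_ncovers.
    move=> y; rewrite !mem_cat mem_rcons inE !mem_iota.
    by case: (boolP (y \in u)) => [/ux|] /=; lia.
  exact: notin_from_mem.
(* Otherwise the upper square [x + 1] takes the lower [x + 1], leaving [x] unmatched and [x + 2]
   blocked, or it takes [x], leaving [x + 1] free. *)
rewrite /free ncovers_notin_from // PoszD.
have xP : x \in u ++ iota x (M - x).
  by rewrite mem_cat mem_iota; apply/orP; right; lia.
rewrite [X in _ + Posz X]ifT; last by rewrite xP.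
have Sx1 y : y \in S -> (x.+1 < y <= M)%N.
  move=> yS; have := Sx y yS; case: (eqVneq x.+1 y) => [e1|]; last lia.
  by move: xS; rewrite e1 yS.
set X2 := ncovers _ [seq z <- _ | z != x.+1.-1] _.
have -> : X2%:Z = c * row_det m (map e u ++ pairmap gap x.+1 S).
  rewrite -(IH x.+1) //; try lia; last by move=> y /ux; lia.
  congr Posz; apply: eq_ncovers => // y; rewrite mem_filter !mem_cat !mem_iota /=.
  by case: (boolP (y \in u)) => [/ux|]; lia.
have eqX1 : [seq z <- u ++ iota x (M - x) | z != x.+1] =i
    rcons u x ++ iota x.+2 (M - x.+2).
  move=> y; rewrite mem_filter !mem_cat mem_rcons inE !mem_iota /=.
  by case: (boolP (y \in u)) => [/ux|] /=; lia.
have ux2 y : y \in rcons u x -> (lo <= y)%N && (y.+1 < x.+2)%N.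
  by rewrite mem_rcons inE => /orP[/eqP->|/ux]; lia.
case: S => [|s S] in pS Sx Sx1 sz xS X2 *.
  rewrite /=; case: ifP => [xP1|]; last by rewrite add0r.
  rewrite (eq_ncovers h eqX1 (fun=> erefl)).
  have xM2 : (x.+2 <= M)%N.
    by move: xP1; rewrite mem_cat mem_iota => /orP[/ux|]; lia.
  have := @blocked_nil x.+2 (rcons u x) xM2; rewrite /blocked => ->.
    by rewrite add0r.
  by move=> y /ux2 /andP[].
have := Sx1 s; rewrite inE eqxx => /(_ isT) sx.
rewrite ifT; last by rewrite mem_cat mem_iota; apply/orP; right; lia.
rewrite (eq_ncovers h eqX1 (fun=> erefl)).
have := @blocked_of_free x.+2 _ (rcons u x) s S pux ux2 pS; rewrite /blocked => -> //.
- rewrite -mulrDr; congr (_ * _) => /=.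
  rewrite map_rcons cat_rcons -(@row_detD _ _ _ _ _ (gap x s)) // ?size_map.
    by move: sz => /=; lia.
  by move=> j; rewrite /gap big_ltn //; lia.
- by move=> x' u' S' x'M; apply: IH; lia.
- by rewrite size_rcons; move: sz => /=; lia.
Qed.

(** No lower square precedes [lo], so the matching starts in the state [blocked] with [u] empty. *)
Lemma ncovers_interlacing s S : band_row h = iota lo (M - lo) -> (lo <= M)%N ->
  pairwise ltn (s :: S) -> size S = m ->
  (forall y, y \in s :: S -> (lo <= y <= M)%N) ->
  (ncovers h.+1 (notin_from lo M (s :: S)) [::])%:Z = c * row_det m (pairmap gap s S).
Proof.
move=> rowE loM pS sz Slo; rewrite ncovers_top rowE.
have := @blocked_of_free lo _ [::] s S isT _ pS Slo sz; apply => //.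
by move=> x u S' /andP[xlo xM]; apply: freeP; rewrite xlo.
Qed.

End Interlacing.

(* Choices sending two squares to the same place contribute a determinant with two
   equal rows, so that all choices may be summed freely. *)
Lemma ncovers_shift (h lo M p : nat) (c : int) (e : nat -> nat -> int) :
  (forall S, pairwise ltn S -> size S = p ->
    (forall y, y \in S -> (lo <= y <= M)%N) ->
    (ncovers h (notin_from lo M S) [::])%:Z = c * row_det p (map e S)) ->
  forall Q S, pairwise ltn S -> pairwise ltn Q -> (size S + size Q = p)%N ->
  (forall y, y \in S -> (lo <= y <= M)%N) ->
  (forall y, y \in Q -> (lo < y <= M)%N) ->
  (forall y z, y \in S -> z \in Q -> (y < z)%N) ->
  (ncovers h (notin_from lo M S) Q)%:Z =
  c * row_det p (map e S ++ map (fun t j => e t j + e t.-1 j) Q).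
Proof.
(* [S] collects the lower squares already taken, while [Q] is emptied from the left. *)
move=> He; elim => [|q Q IH] S pS pQ sz SM QM SQ.
  by rewrite cats0 He // -sz addn0.
move: pQ => /= /andP[/allP qQ pQ].
have := QM q; rewrite inE eqxx => /(_ isT) /andP[loq qM].
have Sq y : y \in S -> (y < q)%N by move=> yS; apply: SQ => //; rewrite inE eqxx.
have qS : q \notin S by apply/negP => /Sq; rewrite ltnn.
have minus z : [seq x <- notin_from lo M S | x != z] =i notin_from lo M (rcons S z).
  move=> y; rewrite mem_filter !mem_notin_from mem_rcons inE negb_or.
  by case: (y != z) => //=; rewrite andbF.
have QM' y : y \in Q -> (lo < y <= M)%N by move=> yQ; apply: QM; rewrite inE yQ orbT.
have step z : z = q \/ z = q.-1 -> z \notin S ->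
    (ncovers h [seq x <- notin_from lo M S | x != z] Q)%:Z =
    c * row_det p (map e S ++ e z :: map (fun t j => e t j + e t.-1 j) Q).
  move=> zq zS; rewrite (eq_ncovers h (minus z) (fun=> erefl)) IH //.
  - by rewrite map_rcons cat_rcons.
  - rewrite pairwise_rcons pS andbT; apply/allP => y yS /=.
    have := Sq y yS; case: (eqVneq y z) => [yz|]; last lia.
    by move: zS; rewrite -yz yS.
  - by rewrite size_rcons -sz /= addnS.
  - by move=> y; rewrite mem_rcons inE => /orP[/eqP->|/SM //]; lia.
  - move=> y t; rewrite mem_rcons inE => /orP[/eqP->|yS] tQ.
      by have /= := qQ t tQ; lia.
    by apply: SQ => //; rewrite inE tQ orbT.
rewrite ncovers_cons; last by apply/negP => /qQ; rewrite /= ltnn.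
rewrite ifT; last by rewrite mem_notin_from qS; lia.
rewrite PoszD step //; last by left.
have -> : (0 < q)%N by lia.
rewrite mem_notin_from (_ : (lo <= q.-1 <= M)%N) /=; last lia.
have szS : (size (map e S) < p)%N by rewrite size_map -sz /=; lia.
rewrite (@row_detD _ _ _ (e q) (e q.-1) (fun j => e q j + e q.-1 j)) // mulrDr.
congr (_ + _).
(* If [q - 1] is already taken, it is the last element of [S], so its row is repeated and the
   determinant vanishes, like the count. *)
case: ifPn => [q1S|]; first by rewrite step //; right.
rewrite negbK => q1S.
case/lastP: S => // S s in pS sz SM SQ Sq qS minus step szS q1S *.
have {q1S} -> : s = q.-1.
  have := Sq s; rewrite mem_rcons inE eqxx => /(_ isT) sq.
  move: pS q1S; rewrite pairwise_rcons mem_rcons inE => /andP[/allP sS _].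
  by move=> /orP[/eqP//|/sS] /=; lia.
rewrite map_rcons cat_rcons row_det_dup ?mulr0 //.
by move: szS; rewrite size_map size_rcons size_map addn1.
Qed.

(** * Induction over pairs of bands, with binomial rows *)

Lemma gap_bin m s S : (m <= s)%N -> pairwise ltn (s :: S) ->
  pairmap (fun a b j => \sum_(a <= x < b) 'C(x - m, j)%:Z) s S =
  pairmap (fun a b j => 'C(b - m, j.+1)%:Z - 'C(a - m, j.+1)%:Z) s S.
Proof.
elim: S s => //= t S IH s ms /andP[/andP[st _] pS].
rewrite IH //=; last exact: leq_trans (ltnW st).
by congr (_ :: _); apply/funext => j; rewrite sum_bin // ms ltnW.
Qed.

Lemma ncovers_even m u : pairwise ltn u -> size u = m ->
  (forall y, y \in u -> (m <= y < m + N)%N) ->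
  (ncovers m.*2 u [::])%:Z =
  2 ^+ 'C(m.+1, 2) * row_det m [seq (fun j => 'C(x - m, j)%:Z) | x <- u].
Proof.
elim: m u => [|m IH] u pu szu um.
  by rewrite (size0nil szu) ncovers0 /row_det det_mx00.
have odd_row S : pairwise ltn S -> size S = m.+1 ->
    (forall y, y \in S -> (m <= y <= m + N)%N) ->
    (ncovers m.*2.+1 (notin_from m (m + N) S) [::])%:Z =
    2 ^+ 'C(m.+1, 2) * row_det m.+1 [seq (fun j => 'C(x - m, j)%:Z) | x <- S].
  case: S => // s S pS [szS] Sm.
  rewrite (ncovers_interlacing IH) ?leq_addr //; last first.
    by rewrite /band_row doubleK odd_double addn0 addKn.
  rewrite gap_bin //; last first.
    by have := Sm s; rewrite inE eqxx => /(_ isT) /andP[].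
  rewrite (@row_det_consecutive _ (fun x j => 'C(x - m, j)%:Z)) // => x.
  by rewrite bin0.
rewrite doubleS ncovers_top.
rewrite (@eq_ncovers _ _ _ (notin_from m (m + N) [::]) u) //; last first.
  move=> y; rewrite mem_notin_from /band_row mem_iota /= odd_double /= uphalf_double; lia.
rewrite (ncovers_shift odd_row) //.
(* The exponent grows by [m + 1], the size of the determinant being doubled row by row. *)
rewrite (binS m.+1) bin1 exprD -mulrA.
rewrite -(@row_det_double _ (fun x j => 'C(x - m.+1, j)%:Z)) //.
congr (_ * row_det _ _).
(* With [x = y - 1 - m], Pascal's rule gives ['C(x + 1, j) + 'C(x, j) = 2 'C(x, j) + 'C(x, j - 1)]
   for positive [j]. *)
rewrite cat0s; apply/eq_in_map => y /um yu; apply/funext => j.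
have -> : (y - m = (y.-1 - m).+1)%N by lia.
have -> : (y - m.+1 = y.-1 - m)%N by lia.
by case: j => [|j]; rewrite ?bin0 // binS; lia.
Qed.

(** * The generalized Aztec diamond in band coordinates *)

Lemma aztecE : aztec N n k = blow_up (region N.*2 (iota N N) [::]).
Proof.
have n0 : (0 < n)%N by apply: leq_trans hkn.
(* Left columns start at level 0 and end with band [2x + 1]; right columns start with band
   [2(x - N) + 1] and end with band [2N]. All ends are thus band boundaries. *)
have memR x l : ((band l, x) \in region N.*2 (iota N N) [::]) =
    ((x < N) && (l < n * x.+1) ||
     [&& N <= x, x < N.*2, n * (x - N) + k.+1 <= l & l < n * N + k.+1])%N.
  have cmp a : (n * a + k.+1 <= l)%N =
      ((a < l %/ n) || (a == l %/ n) && (k < l %% n))%N.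
    have := divn_eq l n; have := ltn_pmod l n0.
    set q := (l %/ n)%N; set r := (l %% n)%N => rn ->.
    have [aq|aq|->] /= := ltngtP a q; last lia.
      have : (n * a.+1 <= n * q)%N by rewrite leq_mul2l aq orbT.
      lia.
    have : (n * q.+1 <= n * a)%N by rewrite leq_mul2l aq orbT.
    lia.
  rewrite in_region in_nil andbF orbF [(l < n * N + _)%N]ltnNge !cmp.
  rewrite mulnC -ltn_divLR // /band /band_row !mem_iota.
  set q := (l %/ n)%N; case: (k < l %% n)%N; rewrite ?addn0 ?addn1 /=.
    by rewrite uphalf_double odd_double /= ?andbT; lia.
  by rewrite doubleK odd_double /= ?andbF; lia.
apply: eq_blow_up => // [c|x l].
  move=> /bigfcupP[j]; rewrite andbT mem_iota => jN.
  rewrite in_fsetU => /orP[] /imfsetP[i /= _ ->].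
    by exists j.-1, i; rewrite /square_at; congr (_, _); lia.
  exists (N.*2 - j)%N, (n * (N - j) + k.+1 + i)%N.
  have [a aE] : exists a, N = (j + a)%N by exists (N - j)%N; lia.
  by rewrite /square_at aE; congr (_, _); nia.
rewrite memR; apply/bigfcupP/orP.
  move=> [j]; rewrite andbT mem_iota => jN.
  rewrite in_fsetU => /orP[] /imfsetP[i /=]; rewrite mem_iota => ij [xE lE].
    left; have -> : x = j.-1 by lia.
    have -> : l = i by lia.
    by rewrite prednK; lia.
  right; have -> : x = (N.*2 - j)%N by lia.
  have [a aE] : exists a, N = (j + a)%N by exists (N - j)%N; lia.
  have -> : l = (n * a + k.+1 + i)%N by nia.
  have -> : (N.*2 - j - N = a)%N by lia.
  by rewrite aE mulnDr; lia.
case=> [/andP[xN lx]|/and4P[Nx xN l1 l2]].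
  exists x.+1; first by rewrite mem_iota; lia.
  rewrite in_fsetU; apply/orP; left; apply/imfsetP.
  exists l; first by rewrite /= mem_iota.
  by rewrite /square_at; congr (_, _); lia.
have [a aE] : exists a, x = (N + a)%N by exists (x - N)%N; lia.
have [j jE] : exists j, N = (j + a)%N by exists (N - a)%N; lia.
have xNa : (x - N = a)%N by lia.
rewrite xNa in l1; rewrite jE mulnDr in l2.
exists j; first by rewrite mem_iota; lia.
rewrite in_fsetU; apply/orP; right; apply/imfsetP.
exists (l - (n * a + k.+1))%N; first by rewrite /= mem_iota; lia.
by rewrite /square_at aE jE; congr (_, _); nia.
Qed.

Lemma card_tilings_aztec : #|` tilings n (aztec N n k)| = (2 ^ 'C(N.+1, 2))%N.
Proof.
rewrite aztecE tilings_blow_up //.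
have := @ncovers_even N (iota N N); rewrite row_det_bin_iota mulr1 => H.
apply/eqP; rewrite -eqz_nat -[X in _ == X]natz natrX; apply/eqP; apply: H.
- by rewrite -sorted_pairwise ?iota_ltn_sorted //; apply: ltn_trans.
- by rewrite size_iota.
- by move=> y; rewrite mem_iota.
Qed.

End Peeling.

Theorem theorem2p5 (R : realType) (n k : nat)
    (hn : (2 <= n)%N) (hk : (k <= n - 2)%N) :
  (forall N : nat, (1 <= N)%N ->
     #|` tilings n (aztec N n k)| = (2 ^ ((N * (N + 1)) %/ 2))%N) /\
  ((fun N : nat =>
      log2 (#|` tilings n (aztec N n k)|%:R : R) / (N * (N + 1))%N%:R)
     @ \oo --> (1 / 2 : R)).
Proof.
have hkn : (k.+2 <= n)%N by lia.
have bin2E N : 'C(N.+1, 2) = ((N * (N + 1)) %/ 2)%N.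
  by rewrite bin2 -divn2 /= addn1 mulnC.
split=> [N _|]; first by rewrite card_tilings_aztec ?bin2E.
(* The sequence is constant only from 1 on: at [N = 0] the quotient is [0 / 0], which is 0 by
   convention. *)
apply: cvg_near_cst; exists 1%N => // N /= N0.
have even : (N * (N + 1) = 2 * ((N * (N + 1)) %/ 2))%N.
  by rewrite [RHS]mulnC divnK // dvdn2 oddM oddD addbT andbN.
rewrite card_tilings_aztec ?bin2E // {2}even; set q := (_ %/ 2)%N.
have q0 : q%:R != 0 :> R by rewrite pnatr_eq0; lia.
have ln2 : ln 2 != 0 :> R by rewrite gt_eqF // ln_gt0 // ltr1n.
by rewrite /log2 natrX lnXn // -mulr_natl natrM; field; rewrite q0 mulr1 ln2.
Qed.
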